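(* Let $k\ge 2$ be an integer. For all integers $n,p,q$ with $p\ge 0$, $$F^{(k)}_{n}F^{(k)}_{n+p+q}-F^{(k)}_{n+p}F^{(k)}_{n+q}=\sum_{i=0}^{p-1}F^{(k)}_{n+q+i,\,n+p-1-i}.$$
   Context: The $k$-bonacci numbers $(F^{(k)}_n)_{n\in\mathbb{Z}}$ are the bi-infinite integer sequence with $F^{(k)}_0=\cdots=F^{(k)}_{k-2}=0$, $F^{(k)}_{k-1}=1$ and $F^{(k)}_n=\sum_{i=1}^k F^{(k)}_{n-i}$ for all $n\in\mathbb{Z}$ (for $k=2$ these are the Fibonacci numbers). Let $\phi_1,\dots,\phi_k\in\mathbb{C}$ be the roots of $x^k-x^{k-1}-\cdots-x-1$; they are distinct and nonzero. For integers $t_1,\dots,t_k$ let $\|t_1,\dots,t_k\|=\det(\phi_i^{t_j})_{1\le i,j\le k}$. The single-index numbers satisfy the Binet formula $F^{(k)}_n=\|0,1,\dots,k-2,n\|/\|0,1,\dots,k-1\|$. The two-index numbers are defined, for $m,n\in\mathbb{Z}$, by $$F^{(k)}_{m,n}=\frac{\|0,1,\dots,k-3,m,n\|}{\|0,1,\dots,k-1\|}$$ (for $k=2$ the numerator is $\|m,n\|$). An empty sum is $0$. *)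

(* Defs.v *)
From HB Require Import structures.
From mathcomp Require Import all_boot all_order all_algebra.
From mathcomp Require Import zify.

Set Implicit Arguments.
Unset Strict Implicit.
Unset Printing Implicit Defensive.

Import Order.TTheory GRing.Theory Num.Theory.
Local Open Scope ring_scope.

(* [k.-1] and [k - 2] are truncated, so the definitions are meant for k >= 2. *)
Definition is_kbonacci (k : nat) (F : int -> int) : Prop :=
  [/\ forall i : nat, (i < k.-1)%N -> F i%:Z = 0,
      F k.-1%:Z = 1
    & forall n : int, F n = \sum_(1 <= i < k.+1) F (n - i%:Z)].

Lemma is_kbonacci_shift (k : nat) (F : int -> int) :
  (forall n : int, F n = \sum_(1 <= i < k.+1) F (n - i%:Z)) <->
  (forall n : int, F (n + k%:Z) = \sum_(i < k) F (n + i%:Z)).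
Proof.
have E n : \sum_(1 <= i < k.+1) F (n + k%:Z - i%:Z) = \sum_(i < k) F (n + i%:Z).
  rewrite big_add1 /= big_mkord (reindex_inj rev_ord_inj) /=.
  apply: eq_bigr => i _; congr F; have := ltn_ord i; lia.
split=> H n; first by rewrite H E.
by have := H (n - k%:Z); rewrite -E !subrK.
Qed.

(* [is_kbonacci k] determines exactly one sequence. *)
Lemma is_kbonacci_exists (k : nat) : (0 < k)%N -> exists F, is_kbonacci k F.
Proof.
move=> k0.
pose fwd (w : nat -> int) i := if (i.+1 < k)%N then w i.+1 else \sum_(j < k) w j.
pose bwd (w : nat -> int) i :=
  if i is i'.+1 then w i' else w k.-1 - \sum_(j < k.-1) w j.
pose w0 i : int := if i == k.-1 then 1 else 0.
pose W (n : int) :=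
  match n with Posz m => iter m fwd w0 | Negz m => iter m.+1 bwd w0 end.
have fb w i : (i < k)%N -> fwd (bwd w) i = w i.
  move=> ik; rewrite /fwd; case: ifP => //= ik'.
  have -> : i = k.-1 by lia.
  case: k k0 {ik ik' fwd W w0} @bwd => // k _ bwd.
  by rewrite big_ord_recl /= subrK.
have step n i : (i < k)%N -> W (n + 1) i = fwd (W n) i.
  move=> ik; case: n => m.
    by have -> : Posz m + 1 = Posz m.+1 by lia.
  have -> : W (Negz m + 1) = iter m bwd w0.
    case: m => [|m]; first by have -> : Negz 0 + 1 = Posz 0 by lia.
    by have -> : Negz m.+1 + 1 = Negz m by lia.
  by rewrite [W _]/= fb.
have win i n : (i < k)%N -> W n i = W (n + i%:Z) 0%N.
  elim: i n => [|i IH] n ik; first by rewrite addr0.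
  have <- : n + 1 + i%:Z = n + i.+1%:Z by lia.
  by rewrite -IH ?(ltnW ik) // step ?(ltnW ik) // /fwd ik.
exists (fun n => W n 0%N); split.
- move=> i ik; rewrite -[i%:Z]add0r -win; last by lia.
  by rewrite /W /= /w0; case: eqP => //; lia.
- rewrite -[k.-1%:Z]add0r -win; last by lia.
  by rewrite /W /= /w0 eqxx.
- apply/(is_kbonacci_shift k (fun n => W n 0%N)) => n.
  have -> : n + k%:Z = n + 1 + k.-1%:Z by lia.
  rewrite -win; last by lia.
  rewrite step /fwd; last by lia.
  rewrite prednK // ltnn; apply: eq_bigr => i _; exact: win.
Qed.

Lemma is_kbonacci_unique (k : nat) (F G : int -> int) :
  (0 < k)%N -> is_kbonacci k F -> is_kbonacci k G -> F =1 G.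
Proof.
move=> k0 [F0 F1 /is_kbonacci_shift FS] [G0 G1 /is_kbonacci_shift GS].
suff H n i : (i < k)%N -> F (n + i%:Z) = G (n + i%:Z).
  by move=> n; have := H n 0%N k0; rewrite addr0.
elim/int_rec: n i => [|n IH|n IH] i ik.
- rewrite add0r; have [ik'|ik'] := ltnP i k.-1; first by rewrite F0 ?G0.
  by have -> : i = k.-1 by [lia]; rewrite F1 G1.
- have [ik'|ik'] := ltnP i.+1 k.
    have -> : n.+1%:Z + i%:Z = n%:Z + i.+1%:Z by lia.
    exact: IH.
  have -> : n.+1%:Z + i%:Z = n%:Z + k%:Z by lia.
  by rewrite FS GS; apply: eq_bigr => j _; apply: IH.
- case: i ik => [|i] ik; last first.
    have -> : - n.+1%:Z + i.+1%:Z = - n%:Z + i%:Z by lia.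
    exact/IH/ltnW.
  have := FS (- n.+1%:Z); have := GS (- n.+1%:Z).
  have -> : - n.+1%:Z + k%:Z = - n%:Z + k.-1%:Z by lia.
  rewrite -IH; last by lia.
  case: k k0 IH {F0 F1 FS G0 G1 GS ik} => // k _ IH.
  move=> ->; rewrite !big_ord_recl => /esym /=.
  have -> : \sum_(i < k) F (- n.+1%:Z + (lift ord0 i)%:Z)
          = \sum_(i < k) G (- n.+1%:Z + (lift ord0 i)%:Z).
    apply: eq_bigr => i _.
    have -> : - n.+1%:Z + (lift ord0 i)%:Z = - n%:Z + i%:Z by rewrite lift0; lia.
    by apply: IH; rewrite ltnS ltnW.
  exact: addIr.
Qed.

Section TwoIndex.
Variable C : numClosedFieldType.

Definition kbonacci_poly (k : nat) : {poly C} := 'X^k - \sum_(i < k) 'X^i.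

(* The roots are listed with multiplicity, in an arbitrary order; the quotient
   defining [kbonacci2] does not depend on that order. *)
Definition kbonacci_roots (k : nat) (phi : 'I_k -> C) : Prop :=
  kbonacci_poly k = \prod_(i < k) ('X - (phi i)%:P).

Lemma kbonacci_roots_exists (k : nat) : exists phi : 'I_k -> C, kbonacci_roots phi.
Proof.
have s : (size (\sum_(i < k) 'X^i : {poly C})%R < k.+1)%N.
  rewrite ltnS; apply: (leq_trans (size_sum _ _ _)).
  by apply/bigmax_leqP => i _; rewrite size_polyXn.
have sz : size (kbonacci_poly k) = k.+1.
  by rewrite /kbonacci_poly size_polyDl ?size_polyXn // size_polyN.
have lc : lead_coef (kbonacci_poly k) = 1.
  by rewrite /kbonacci_poly lead_coefDl ?lead_coefXn // size_polyXn size_polyN.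
have [r Er] := closed_field_poly_normal (kbonacci_poly k).
rewrite lc scale1r in Er.
have sr : size r = k by move: sz; rewrite Er size_prod_XsubC => -[].
exists (fun i => r`_i); rewrite /kbonacci_roots Er.
by rewrite (big_nth 0) big_mkord sr.
Qed.

(* ||t_1, ..., t_k||; only meaningful when [size t = k], since t`_j is 0 past
   the end of [t]. *)
Definition expdet (k : nat) (phi : 'I_k -> C) (t : seq int) : C :=
  \det (\matrix_(i < k, j < k) phi i ^ t`_j).

Definition kbonacci2 (k : nat) (phi : 'I_k -> C) (m n : int) : C :=
  expdet phi ([seq j%:Z | j <- iota 0 (k - 2)] ++ [:: m; n])
  / expdet phi [seq j%:Z | j <- iota 0 k].

End TwoIndex.

(* Main.v *)
Require Import Defs.
From mathcomp Require Import all_boot all_order all_algebra.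
From mathcomp Require Import zify ring.

Set Implicit Arguments.
Unset Strict Implicit.
Unset Printing Implicit Defensive.

Import Order.TTheory GRing.Theory Num.Theory.
Local Open Scope ring_scope.

(** Modulo the characteristic polynomial, every power [x ^ n], n in Z, is a
    combination of 1, x, ..., x ^ (k-1) whose integer coefficients depend on n
    alone; call them the coordinates of n.  Hence the matrix with columns
    [phi ^ t_j] is the Vandermonde matrix of the roots times the matrix of the
    coordinates of the exponents t_j ([expz_kbonacci_coord]).  The roots being
    distinct ([kbonacci_roots_inj]), the Vandermonde determinant cancels in the
    quotient [kbonacci2], and the two-index number is the determinant of the
    coordinate matrix of 0, ..., k-3, m, n.  Its first k-2 columns are unit
    vectors, so only the last two coordinates of m and n matter.  These are
    [F (n + 1) - F n] and [F n], whence ([kbonacci2E])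
      F_{m,n} = F_{m+1} F_n - F_m F_{n+1}.
    With this formula the i-th summand of the theorem is G (i + 1) - G i, where
    G i = F_{n+q+i} F_{n+p-i}, and the sum telescopes. *)

(** * Coordinates of integer powers modulo the characteristic polynomial *)

(** The coefficient of [x ^ l] in [x ^ n].  The closed form comes from unrolling
    [kbonacci_coord0S] and [kbonacci_coordSS], which say how multiplication by x
    acts: coefficients move up by one degree, and the top one, [F n], is added
    to all of them because [x ^ k = 1 + x + ... + x ^ (k-1)]. *)
Definition kbonacci_coord (F : int -> int) (l : nat) (n : int) : int :=
  \sum_(j < l.+1) F (n - j.+1%:Z).

Lemma kbonacci_coord0S (F : int -> int) (n : int) :
  kbonacci_coord F 0 (n + 1) = F n.
Proof. by rewrite /kbonacci_coord big_ord1 addrK. Qed.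

Lemma kbonacci_coordSS (F : int -> int) (l : nat) (n : int) :
  kbonacci_coord F l.+1 (n + 1) = kbonacci_coord F l n + F n.
Proof.
rewrite /kbonacci_coord big_ord_recl addrK addrC; congr (_ + _).
apply: eq_bigr => j _; congr F; rewrite lift0; lia.
Qed.

Section Coordinates.
Variables (k : nat) (F : int -> int).
Hypotheses (k_gt0 : (0 < k)%N) (hF : is_kbonacci k F).

(** The closed form of the top coordinate is the right-hand side of the
    recurrence. *)
Lemma kbonacci_coord_last (n : int) : kbonacci_coord F k.-1 n = F n.
Proof.
have [_ _ ->] := hF.
by rewrite /kbonacci_coord prednK // big_add1 big_mkord.
Qed.

Lemma kbonacci_coord_penult (n : int) : (1 < k)%N ->
  kbonacci_coord F (k - 2) n = F (n + 1) - F n.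
Proof.
move=> k_gt1; rewrite -(kbonacci_coord_last (n + 1)).
have -> : k.-1 = (k - 2).+1 by lia.
by rewrite kbonacci_coordSS addrK.
Qed.

(** For [m < k] the power [x ^ m] is already reduced.  Multiplication by x shifts
    the coordinates without feedback as long as [F m = 0], that is [m < k - 1],
    which leaves the case of exponent 0. *)
Lemma kbonacci_coord_nat (l m : nat) : (l < k)%N -> (m < k)%N ->
  kbonacci_coord F l m%:Z = (l == m)%:Z.
Proof.
have [F0 F1 Frec] := hF.
elim: m l => [|m IH] l lk mk; last first.
  have -> : m.+1%:Z = m%:Z + 1 by lia.
  have Fm : F m%:Z = 0 by apply: F0; lia.
  case: l lk => [|l] lk; first by rewrite kbonacci_coord0S Fm.
  by rewrite kbonacci_coordSS Fm addr0 IH ?eqSS //; lia.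
(* The sum F(-1) + ... + F(-1-l) is what remains of the recurrence for
   F(k-1-l) once its terms of index 0, ..., k-2-l, all zero, are removed. *)
have -> : kbonacci_coord F l 0%N = F (k.-1 - l)%N%:Z.
  rewrite Frec (@big_cat_nat _ _ _ (k - l)%N) /=; try lia.
  rewrite big_nat big1 ?add0r; last first.
    move=> i ik.
    have -> : (k.-1 - l)%N%:Z - i%:Z = (k.-1 - l - i)%N%:Z by lia.
    by apply: F0; lia.
  rewrite -{1}[(k - l)%N]add0n big_addn big_mkord /kbonacci_coord.
  have -> : (k.+1 - (k - l))%N = l.+1 by lia.
  by apply: eq_bigr => j _; congr F; lia.
case: l lk => [|l] lk; first by rewrite subn0 F1.
by rewrite F0 //; lia.
Qed.

(** Both sides are multiplied by x when n grows by one, and they agree at 0; as x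
    is invertible this determines them on all of Z. *)
Lemma expz_kbonacci_coord (R : fieldType) (x : R) (n : int) :
  x ^+ k = \sum_(i < k) x ^+ i -> x != 0 ->
  x ^ n = \sum_(l < k) x ^+ l * (kbonacci_coord F l n)%:~R.
Proof.
move=> xk x0; pose S n := \sum_(l < k) x ^+ l * (kbonacci_coord F l n)%:~R.
have step m : S (m + 1) = x * S m.
  have cl := kbonacci_coord_last m.
  rewrite /S; case: k k_gt0 xk cl => // d _ xd /= cl.
  rewrite big_ord_recl /= kbonacci_coord0S mul1r.
  rewrite [in RHS]big_ord_recr /= cl mulrDr mulrA -exprS xd.
  rewrite big_ord_recl /= mulrDl mul1r addrCA; congr (_ + _).
  rewrite mulr_sumr mulr_suml -big_split /=; apply: eq_bigr => l _.
  by rewrite kbonacci_coordSS rmorphD /= mulrDr exprS mulrA.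
have S0 : S 0 = 1.
  rewrite /S (bigD1 (Ordinal k_gt0)) //= kbonacci_coord_nat //= mulr1.
  rewrite big1 ?addr0 // => l l0.
  rewrite (kbonacci_coord_nat (ltn_ord l) k_gt0).
  by rewrite -[_ == 0%N]/(l == Ordinal k_gt0) (negbTE l0) mulr0.
rewrite -/(S n); elim/int_rec: n => [|n IH|n IH].
- by rewrite S0.
- by rewrite -addn1 PoszD step -IH addrC expfzDr.
- apply: (mulfI x0); rewrite -step -{1}[x]expr1z -expfzDr //.
  by have -> : - n.+1%:Z + 1 = - n%:Z by [lia]; rewrite -IH; congr (_ ^ _); lia.
Qed.

End Coordinates.

(** * The roots are distinct and nonzero *)

Section Roots.
Variables (C : numClosedFieldType) (k : nat) (phi : 'I_k -> C).
Hypothesis hphi : kbonacci_roots phi.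

Lemma kbonacci_rootE (i : 'I_k) : phi i ^+ k = \sum_(j < k) phi i ^+ j.
Proof.
have /(congr1 (fun p => p.[phi i])) := hphi.
rewrite horner_prod (bigD1 i) //= hornerXsubC subrr mul0r.
rewrite /kbonacci_poly hornerD hornerN hornerXn horner_sum => /subr0_eq ->.
by apply: eq_bigr => j _; rewrite hornerXn.
Qed.

Lemma kbonacci_root_neq0 (i : 'I_k) : phi i != 0.
Proof.
apply/eqP => x0; have := kbonacci_rootE i; rewrite x0.
have k_gt0 : (0 < k)%N := leq_ltn_trans (leq0n i) (ltn_ord i).
rewrite expr0n gtn_eqF // (bigD1 (Ordinal k_gt0)) //= expr0 big1 => [|j j0].
  by rewrite addr0 => /esym/eqP; rewrite oner_eq0.
by rewrite expr0n -[_ == 0%N]/(j == Ordinal k_gt0) (negbTE j0).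
Qed.

(** A double root a of the characteristic polynomial is also a double root of its
    product with X - 1, the trinomial [X^(k+1) - 2 X^k + 1].  The derivative gives
    [a (k + 1) = 2 k]; substituting this in [a ^ k (2 - a) = 1] gives
    [(2 k) ^ k * 2 = (k + 1) ^ (k + 1)] in the natural numbers.  Then k divides
    a power of k + 1, to which it is coprime, so k = 1. *)
Lemma kbonacci_roots_inj : (1 < k)%N -> injective phi.
Proof.
move=> k_gt1 i j eq_ij; apply/eqP/negPn/negP => ne_ij.
set a := phi i.
have [g Eg] : exists g, 'X^(k.+1) - 'X^k *+ 2 + 1 = ('X - a%:P) ^+ 2 * g :> {poly C}.
  have : ('X - 1) * kbonacci_poly C k = 'X^(k.+1) - 'X^k *+ 2 + 1.
    rewrite /kbonacci_poly mulrBr -subrX1 exprS; ring.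
  rewrite hphi (bigD1 i) //= (bigD1 j) 1?eq_sym //= -eq_ij -/a => <-.
  set r := \prod_(_ | _) _; exists (('X - 1) * r); ring.
have a0 : a != 0 := kbonacci_root_neq0 i.
have h0 : a ^+ k * (a - 2%:R) = - 1.
  have /(congr1 (fun p => p.[a])) := Eg.
  rewrite hornerM horner_exp hornerXsubC subrr expr0n mul0r.
  rewrite !(hornerD, hornerN, hornerMn, hornerXn, hornerC) => /eqP.
  rewrite addr_eq0 => /eqP <-; rewrite exprS; ring.
have h1 : a * k.+1%:R = (2 * k)%:R.
  have /(congr1 (fun p => p^`().[a])) := Eg.
  rewrite derivM deriv_exp !derivE.
  rewrite !(hornerD, hornerM, hornerMn, hornerN, hornerXn, horner_exp, hornerC, hornerX).
  rewrite subrr.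
  have -> : (k = k.-1.+1)%N by lia.
  move: (k.-1) => d /=; rewrite exprS => H.
  have ad : a ^+ d != 0 by rewrite expf_neq0.
  apply: (mulfI ad); apply/eqP; rewrite -subr_eq0; apply/eqP.
  apply: etrans (etrans H _); ring.
have : ((2 * k) ^ k * 2 = k.+1 ^ k.+1)%N.
  apply/eqP; rewrite -(eqr_nat C) natrM !natrX -h1; apply/eqP.
  have -> : 2%:R = (2%:R - a) * k.+1%:R :> C.
    by rewrite mulrBl h1 -natrM -natrB; [congr _%:R | ]; lia.
  have h2 : a ^+ k * (2%:R - a) = 1 by rewrite -[LHS]opprK -mulrN opprB h0 opprK.
  by rewrite exprMn mulrACA h2 mul1r -exprSr.
move=> E; suff : k = 1%N by lia.
have /gcdn_idPl <- : (k %| k.+1 ^ k.+1)%N.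
  by rewrite -E dvdn_mulr // dvdn_exp ?(ltnW k_gt1) // dvdn_mull.
by apply/eqP; rewrite -/(coprime _ _) coprimeXr // coprimenS.
Qed.

Lemma kbonacci_vandermonde_neq0 : (1 < k)%N ->
  \det (\matrix_(i < k, j < k) phi i ^+ j) != 0.
Proof.
move=> /kbonacci_roots_inj phi_inj.
have -> : \matrix_(i < k, j < k) phi i ^+ j = (Vandermonde k (\row_i phi i))^T.
  by apply/matrixP => i j; rewrite !mxE.
rewrite det_tr det_Vandermonde.
apply/prodf_neq0 => i _; apply/prodf_neq0 => j ij.
by rewrite !mxE subr_eq0; apply/eqP => /phi_inj ji; rewrite ji ltnn in ij.
Qed.

End Roots.

(** * The two-index numbers in terms of the single-index ones *)

(** The Vandermonde factor cancels, and the coordinate matrix that remains is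
    block upper triangular with an identity block of size k - 2, so its
    determinant is the 2 x 2 determinant of the last two coordinates of m
    and n. *)
Lemma kbonacci2E (C : numClosedFieldType) (k : nat) (k_gt1 : (1 < k)%N)
    (F : int -> int) (hF : is_kbonacci k F)
    (phi : 'I_k -> C) (hphi : kbonacci_roots phi) (m n : int) :
  kbonacci2 phi m n = (F (m + 1) * F n - F m * F (n + 1))%:~R.
Proof.
have k_gt0 := ltnW k_gt1.
rewrite /kbonacci2; set t := _ ++ _.
pose V := \matrix_(i < k, j < k) phi i ^+ j.
pose B := \matrix_(l < k, j < k) kbonacci_coord F l t`_j.
have -> : expdet phi [seq j%:Z | j <- iota 0 k] = \det V.
  congr (\det _); apply/matrixP => i j.
  by rewrite !mxE (nth_map 0%N) ?size_iota ?nth_iota.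
have -> : expdet phi t = \det V * (\det B)%:~R.
  rewrite -det_map_mx -det_mulmx; congr (\det _); apply/matrixP => i j.
  rewrite !mxE (expz_kbonacci_coord k_gt0 hF _ (kbonacci_rootE hphi i)).
    by apply: eq_bigr => l _; rewrite !mxE.
  exact: kbonacci_root_neq0.
rewrite mulrC mulKf ?kbonacci_vandermonde_neq0 //; congr _%:~R.
(* Writing k as d + 2 in the type of B makes the block decomposition visible. *)
have [d dk] : exists d, k = (d + 2)%N by exists (k - 2)%N; lia.
have c1 := kbonacci_coord_last k_gt0 hF.
have c2 x := kbonacci_coord_penult k_gt0 hF x k_gt1.
have cn := kbonacci_coord_nat k_gt0 hF.
clear V hF hphi k_gt0; subst k.
rewrite addnK in c2 t B *; have {}c1 x : kbonacci_coord F d.+1 x = F x.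
  by rewrite -c1 addn2.
have tl (j : 'I_d) : t`_j = j%:Z.
  by rewrite nth_cat size_map size_iota ltn_ord (nth_map 0%N) ?size_iota ?nth_iota.
have t0 : t`_d = m by rewrite nth_cat size_map size_iota ltnn subnn.
have t1 : t`_d.+1 = n by rewrite nth_cat size_map size_iota ltnNge leqnSn /= subSnn.
have -> : B = block_mx 1%:M (ursubmx B) 0 (drsubmx B).
  rewrite -[LHS]submxK; congr block_mx; apply/matrixP => l j; rewrite !mxE /= tl.
    rewrite cn ?natz //; have := ltn_ord l; have := ltn_ord j; lia.
  rewrite cn; have := ltn_ord l; have := ltn_ord j; lia.
rewrite det_ublock det1 mul1r.
rewrite (expand_det_row _ 0) big_ord_recl big_ord1 /cofactor !det_mx11 !mxE /=.
rewrite /bump /= !addn0 !addn1 t0 t1 !c1 !c2; ring.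
Qed.

Theorem theorem4p4 (C : numClosedFieldType) (k : nat) (hk : (2 <= k)%N)
    (F : int -> int) (hF : is_kbonacci k F)
    (phi : 'I_k -> C) (hphi : kbonacci_roots phi)
    (n q : int) (p : nat) :
  (F n * F (n + p%:Z + q) - F (n + p%:Z) * F (n + q))%:~R
  = \sum_(0 <= i < p) kbonacci2 phi (n + q + i%:Z) (n + p%:Z - 1 - i%:Z).
Proof.
pose G i := F (n + q + i%:Z) * F (n + p%:Z - i%:Z).
have -> : F n * F (n + p%:Z + q) - F (n + p%:Z) * F (n + q) = G p - G 0%N.
  rewrite mulrC [in X in _ - X]mulrC; congr (F _ * F _ - F _ * F _); lia.
rewrite -(telescope_sumr _ (leq0n p)) rmorph_sum; apply: eq_bigr => i _.
rewrite (kbonacci2E hk hF hphi) /G; congr ((F _ * F _ - F _ * F _)%:~R); lia.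
Qed.
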